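(* Let $A\in\mathbb{R}^{l\times m}$, $B\in\mathbb{R}^{n\times m}$ with $C=\ker A\cap\mathbb{R}^m_>\neq\emptyset$, and let $P$, $d_P$, $D$, $d$, $H$, $Y_c$, $p$ and the map $F\colon\mathbb{R}^{d_P}\to\mathbb{R}^d_>$ be as defined in the context. Then the following are equivalent: (a) for all $c\in\mathbb{R}^m_>$, $|Y_c|=1$ and $y\in Y_c$ is nondegenerate; (b) the map $F$ is bijective and $\ker J_F(\xi)=\{0\}$ for all $\xi\in\mathbb{R}^{d_P}$, where $J_F$ denotes the Jacobian matrix of $F$.
   Context: Notation: $\mathbb{R}_>$ are the positive reals, $\mathbb{R}_\ge$ the nonnegative reals, $1_m\in\mathbb{R}^m$ is the all-ones vector. For $x\in\mathbb{R}^m_>$ and $y\in\mathbb{R}^m$, $x^y=\prod_i x_i^{y_i}$; for a matrix $Y=(y^1,\ldots,y^r)\in\mathbb{R}^{m\times r}$ with columns $y^j$, $x^Y\in\mathbb{R}^r_>$ has components $(x^Y)_j=x^{y^j}$. Coefficient polytope: $P=C\cap\Delta$ with $C=\ker A\cap\mathbb{R}^m_>$ (assumed nonempty) and $\Delta=\{y\in\mathbb{R}^m_\ge\mid 1_m\cdot y=1\}$; $d_P=\dim P$. $P$ is relatively open; its closure $\overline P$ is a polytope with vertices $v^1,\ldots,v^{n_P}\in\mathbb{R}^m$. Subspaces: $\mathcal{A}=\begin{pmatrix}A\\1_m^{\mathsf T}\end{pmatrix}$, $T=\ker\mathcal{A}$ (of dimension $d_P$), $T=\operatorname{im}G$ with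 $G\in\mathbb{R}^{m\times d_P}$ having orthonormal columns. $\mathcal{B}=\begin{pmatrix}B\\1_m^{\mathsf T}\end{pmatrix}$, $D=\ker\mathcal{B}$, $d=\dim D$, $D=\operatorname{im}H$ with basis matrix $H\in\mathbb{R}^{m\times d}$. Solution set on the polytope: $Y_c=\{y\in P\mid y^z=c^z\text{ for all }z\in D\}=\{y\in P\mid y^H=c^H\}$. Parametrization of $P$ (a real analytic isomorphism $\mathbb{R}^{d_P}\to P$): \[ p(\xi)=\frac{\sum_{k=1}^{n_P}\mathrm{e}^{v^k\cdot G\xi}\,v^k}{\sum_{k=1}^{n_P}\mathrm{e}^{v^k\cdot G\xi}} . \] A solution $y=p(\xi)\in Y_c$ is called nondegenerate if the Jacobian matrix at $\xi$ of the map $\xi\mapsto p(\xi)^H-c^H$ is injective. The map $F$ is $F\colon\mathbb{R}^{d_P}\to\mathbb{R}^d_>$, $F(\xi)=p(\xi)^H$. *)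

(* Defs.v *)
From HB Require Import structures.
From mathcomp Require Import all_boot all_order all_algebra.
From mathcomp Require Import all_classical all_reals all_analysis.
Import Order.TTheory GRing.Theory Num.Theory.
Import numFieldNormedType.Exports.

Set Implicit Arguments.
Unset Strict Implicit.
Unset Printing Implicit Defensive.

Local Open Scope classical_set_scope.
Local Open Scope ring_scope.

(* Points of R^n are row vectors 'rV[R]_n, as required by the Jacobian 'J of
   derive.v; the matrices A, B, G, H keep their usual shape and act on columns,
   so "A x" is A *m x^T. A linear subspace of R^m is the row space of a matrix. *)

Definition pos_orthant {R : realType} {n : nat} : set 'rV[R]_n :=
  [set x : 'rV[R]_n | forall i, 0 < x 0 i].

Definition dotv {R : realType} {n : nat} (x y : 'rV[R]_n) : R :=
  \sum_(i < n) x 0 i * y 0 i.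

Definition monomial {R : realType} {m : nat} (x y : 'rV[R]_m) : R :=
  \prod_(i < m) (x 0 i `^ y 0 i).

Definition monomials {R : realType} {m r : nat} (x : 'rV[R]_m)
  (Y : 'M[R]_(m, r)) : 'rV[R]_r := \row_(j < r) monomial x (col j Y)^T.

Definition coef_cone {R : realType} {l m : nat} (A : 'M[R]_(l, m)) :
  set 'rV[R]_m := [set x : 'rV[R]_m | A *m x^T = 0] `&` pos_orthant.

Definition std_simplex {R : realType} {m : nat} : set 'rV[R]_m :=
  [set y : 'rV[R]_m | (forall i, 0 <= y 0 i) /\ dotv (const_mx 1 : 'rV[R]_m) y = 1].

Definition coef_polytope {R : realType} {l m : nat} (A : 'M[R]_(l, m)) :
  set 'rV[R]_m := coef_cone A `&` std_simplex.

(* Dimension of the affine hull of S, i.e. of the linear span of S - S, as the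
   largest number of linearly independent differences of points of S
   (0 if S is empty). *)
Definition affine_dim {R : realType} {m : nat} (S : set 'rV[R]_m) : nat :=
  \max_(k < m.+1 | `[< exists M : 'M[R]_(k, m), row_free M /\
      forall i, exists x y, [/\ S x, S y & row i M = x - y] >]) k.

Definition dimP {R : realType} {l m : nat} (A : 'M[R]_(l, m)) : nat :=
  affine_dim (coef_polytope A).

(* The vertices of a polytope are its extreme points. *)
Definition vertices {R : realType} {m : nat} (K : set 'rV[R]_m) :
  set 'rV[R]_m :=
  [set v : 'rV[R]_m | K v /\ forall (x y : 'rV[R]_m) (t : R), K x -> K y -> 0 < t < 1 ->
                    v = t *: x + (1 - t) *: y -> x = v /\ y = v].

Definition augment {R : realType} {l m : nat} (A : 'M[R]_(l, m)) :
  'M[R]_(l + 1, m) := col_mx A (const_mx 1).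

(* Since kermx is the left kernel, the row space of this matrix is
   { x | augment A *m x^T = 0 }. *)
Definition ker_augment {R : realType} {l m : nat} (A : 'M[R]_(l, m)) :
  'M[R]_m := kermx (augment A)^T.

Definition dimD {R : realType} {n m : nat} (B : 'M[R]_(n, m)) : nat :=
  \rank (ker_augment B).

(* S stands for its row space, which the columns of G (resp. H below) span. *)
Definition orthonormal_basis_mx {R : realType} {m k : nat}
  (G : 'M[R]_(m, k)) (S : 'M[R]_m) : Prop :=
  G^T *m G = 1%:M /\ (G^T :=: S)%MS.

Definition basis_mx {R : realType} {m k : nat}
  (H : 'M[R]_(m, k)) (S : 'M[R]_m) : Prop :=
  row_free H^T /\ (H^T :=: S)%MS.

Definition solutions {R : realType} {l n m : nat} (A : 'M[R]_(l, m))
  (B : 'M[R]_(n, m)) (c : 'rV[R]_m) : set 'rV[R]_m :=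
  [set y : 'rV[R]_m | coef_polytope A y /\
     forall z : 'rV[R]_m, (z <= ker_augment B)%MS -> monomial y z = monomial c z].

Definition param {R : realType} {m k N : nat} (v : 'I_N -> 'rV[R]_m)
  (G : 'M[R]_(m, k)) (xi : 'rV[R]_k) : 'rV[R]_m :=
  (\sum_(i < N) expR (dotv (v i) (G *m xi^T)^T))^-1 *:
  \sum_(i < N) expR (dotv (v i) (G *m xi^T)^T) *: v i.

Definition Fmap {R : realType} {m k d N : nat} (v : 'I_N -> 'rV[R]_m)
  (G : 'M[R]_(m, k)) (H : 'M[R]_(m, d)) (xi : 'rV[R]_k) : 'rV[R]_d :=
  monomials (param v G xi) H.

(* 'J f xi is the transpose of the usual Jacobian matrix: the derivative of f at
   xi is u |-> u *m 'J f xi. *)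
Definition nondegenerate_sol {R : realType} {m k d N : nat} (v : 'I_N -> 'rV[R]_m)
  (G : 'M[R]_(m, k)) (H : 'M[R]_(m, d)) (c y : 'rV[R]_m) : Prop :=
  exists2 xi : 'rV[R]_k, y = param v G xi &
    injective (fun u : 'rV[R]_k =>
      u *m 'J (fun x : 'rV[R]_k => monomials (param v G x) H - monomials c H) xi).

(* Main.v *)
Require Import Defs.
From mathcomp Require Import all_boot all_order all_algebra.
From mathcomp Require Import all_classical all_reals all_analysis.
From mathcomp Require Import ring lra.
Import Order.TTheory GRing.Theory Num.Theory.
Import numFieldNormedType.Exports.
Local Open Scope classical_set_scope.
Local Open Scope ring_scope.

(** The equivalence is a change of variables: (a) speaks of points [y] of the
    polytope P and of right-hand sides [c], while (b) speaks of parameters [xi]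
    and of values of F. Two facts translate between them.

    First, [c] enters only through c^H, and c^H takes every positive value:
    in logarithmic coordinates c |-> c^H is the linear map given by the basis
    matrix [H] ([monomialsE], [monomials_eqP], [monomials_surj]).

    Second, [param v G] is a bijection from the parameter space onto P
    ([param_polytope], [param_inj], [param_surj]). Hence the solutions for [c]
    correspond to the solutions [xi] of F xi = c^H; and subtracting the constant
    c^H does not change the Jacobian matrix ([jacobian_sub_cst]), so that
    nondegeneracy at [xi] is triviality of the kernel of J_F at [xi].

    The second fact carries the work. The map [param v G] is a moment map, the
    gradient of a log-sum-exp function with exponents the vertices of P. Its
    injectivity is strict convexity of that function, and a preimage of y in P
    is a minimizer of the convex function xi |-> sum_i exp ((v_i - y) . G xi).
    Both strict convexity and existence of the minimizer say that, for every
    nonzero direction u of P, some vertex v_i satisfies v_i . u > y . u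
    ([vertex_gap]). This in turn holds because [y] is relatively interior and
    because a linear functional on the closure of P is dominated by its values
    at vertices ([vertex_dominates]). *)

(** * The scalar product *)

Lemma dotvE {R : realType} {m : nat} (x y : 'rV[R]_m) :
  dotv x y = (x *m y^T) 0 0.
Proof. by rewrite mxE; apply: eq_bigr => i _; rewrite mxE. Qed.

Lemma dotvC {R : realType} {m : nat} (x y : 'rV[R]_m) : dotv x y = dotv y x.
Proof. by apply: eq_bigr => i _; rewrite mulrC. Qed.

Lemma dotvDl {R : realType} {m : nat} (x y z : 'rV[R]_m) :
  dotv (x + y) z = dotv x z + dotv y z.
Proof. by rewrite !dotvE mulmxDl mxE. Qed.

Lemma dotvZl {R : realType} {m : nat} a (x z : 'rV[R]_m) :
  dotv (a *: x) z = a * dotv x z.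
Proof. by rewrite !dotvE -scalemxAl mxE. Qed.

Lemma dotvNl {R : realType} {m : nat} (x z : 'rV[R]_m) :
  dotv (- x) z = - dotv x z.
Proof. by rewrite -scaleN1r dotvZl mulN1r. Qed.

Lemma dotvDr {R : realType} {m : nat} (x y z : 'rV[R]_m) :
  dotv x (y + z) = dotv x y + dotv x z.
Proof. by rewrite dotvC dotvDl !(dotvC _ x). Qed.

Lemma dotvZr {R : realType} {m : nat} a (x z : 'rV[R]_m) :
  dotv x (a *: z) = a * dotv x z.
Proof. by rewrite dotvC dotvZl dotvC. Qed.

Lemma dotvNr {R : realType} {m : nat} (x z : 'rV[R]_m) :
  dotv x (- z) = - dotv x z.
Proof. by rewrite dotvC dotvNl dotvC. Qed.

Lemma dotv_suml {R : realType} {m N : nat} (x : 'I_N -> 'rV[R]_m) z :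
  dotv (\sum_i x i) z = \sum_i dotv (x i) z.
Proof.
by rewrite dotvE mulmx_suml summxE; apply: eq_bigr => i _; rewrite dotvE.
Qed.

Lemma dotv_delta {R : realType} {m : nat} (x : 'rV[R]_m) i :
  dotv (delta_mx 0 i) x = x 0 i.
Proof.
rewrite /dotv (bigD1 i) //= big1 ?addr0 ?mxE ?eqxx ?mul1r // => j /negPf ji.
by rewrite mxE ji andbF mul0r.
Qed.

Lemma dotv_sq_ge {R : realType} {m : nat} (x : 'rV[R]_m) i :
  x 0 i ^+ 2 <= dotv x x.
Proof.
rewrite /dotv (bigD1 i) //= expr2 lerDl sumr_ge0 // => j _.
exact: sqr_ge0.
Qed.

Lemma dotv_ge0 {R : realType} {m : nat} (x : 'rV[R]_m) : 0 <= dotv x x.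
Proof. by apply: sumr_ge0 => j _; exact: sqr_ge0. Qed.

Lemma dotv_eq0 {R : realType} {m : nat} (x : 'rV[R]_m) : dotv x x <= 0 -> x = 0.
Proof.
move=> x0; apply/rowP => i; rewrite mxE; apply/eqP; rewrite -sqrf_eq0 eq_le.
by rewrite (le_trans (dotv_sq_ge x i) x0) sqr_ge0.
Qed.

Lemma mulmx_tr_dotv {R : realType} {l m : nat} (A : 'M[R]_(l, m))
    (y : 'rV[R]_m) i : (A *m y^T) i 0 = dotv (row i A) y.
Proof. by rewrite mxE; apply: eq_bigr => j _; rewrite !mxE. Qed.

Lemma dotv_mulmx {R : realType} {m k : nat} (G : 'M[R]_(m, k)) (w : 'rV[R]_m)
    (e : 'rV[R]_k) : dotv w (e *m G^T) = dotv (w *m G) e.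
Proof. by rewrite !dotvE trmx_mul trmxK mulmxA. Qed.

Lemma dotv_orthonormal {R : realType} {m k : nat} (G : 'M[R]_(m, k))
    (e : 'rV[R]_k) :
  G^T *m G = 1%:M -> dotv (e *m G^T) (e *m G^T) = dotv e e.
Proof. by move=> GG; rewrite dotv_mulmx -mulmxA GG mulmx1. Qed.

Lemma dotv_sum1 {R : realType} {m : nat} (x : 'rV[R]_m) :
  dotv (const_mx 1) x = \sum_i x 0 i.
Proof. by apply: eq_bigr => i _; rewrite mxE mul1r. Qed.

(** * Continuity and closures *)

Lemma continuous_sumr {R : realType} {T : topologicalType} {N : nat}
    (F : 'I_N -> T -> R) :
  (forall i, continuous (F i)) -> continuous (fun x => \sum_i F i x).
Proof. by move=> Fc; apply: continuous_big => //; exact: add_continuous. Qed.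

Lemma continuous_dotv {R : realType} {m : nat} (w : 'rV[R]_m) :
  continuous (dotv w).
Proof.
apply: (@continuous_sumr _ _ _ (fun i (x : 'rV_m) => w 0 i * x 0 i)) => i x.
apply: continuousM; first exact: cst_continuous.
exact: (@coord_continuous R 1 m 0 i x).
Qed.

(** Closed conditions pass to the closure; a linear equation is two of them. *)
Lemma closure_ge0 {R : realType} {T : topologicalType} (S : set T) (f : T -> R) :
  continuous f -> (forall x, S x -> 0 <= f x) ->
  forall x, closure S x -> 0 <= f x.
Proof.
move=> cf S0 x Sx.
have cl : closed (f @^-1` [set y | 0 <= y]).
  by apply: preimage_closed; [move=> y _; exact: cf|exact: (@closed_ge R 0)].
exact/cl/(closureS _ Sx).
Qed.

(** * The closed polytope *)

(** The compact polytope cut out of the simplex by [A]; it is the closure of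
    [coef_polytope A] when the latter is nonempty, but unlike a closure it is
    described by equations and sign conditions that can be computed with. *)
Definition closed_polytope {R : realType} {l m : nat} (A : 'M[R]_(l, m)) :
  set 'rV[R]_m := [set x : 'rV[R]_m | A *m x^T = 0] `&` std_simplex.

Lemma sumr_gt0 {R : realType} {N : nat} (F : 'I_N -> R) :
  (0 < N)%N -> (forall i, 0 < F i) -> 0 < \sum_i F i.
Proof.
move=> N0 F0; rewrite (bigD1 (Ordinal N0)) //=.
by rewrite ltr_wpDr // sumr_ge0 // => i _; exact: ltW.
Qed.

Lemma coef_polytope_neq0 {R : realType} {l m : nat} (A : 'M[R]_(l, m)) :
  (0 < m)%N -> coef_cone A !=set0 -> coef_polytope A !=set0.
Proof.
move=> m0 [x [Ax xp]].
have s0 : 0 < \sum_i x 0 i.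
  exact: sumr_gt0.
exists ((\sum_i x 0 i)^-1 *: x).
have p i : 0 < ((\sum_i x 0 i)^-1 *: x) 0 i by rewrite mxE mulr_gt0 ?invr_gt0 ?xp.
split; split.
- by rewrite /= linearZ /= -scalemxAr Ax scaler0.
- exact: p.
- by move=> i; exact/ltW/p.
- by rewrite dotvZr dotv_sum1 mulVf ?gt_eqF.
Qed.

(** The inclusion from right to left is the standard fact about relative
    interiors: the half-open segment from an arbitrary point of the closed
    polytope towards a strictly positive one consists of positive points. *)
Lemma closure_coef_polytope {R : realType} {l m : nat} (A : 'M[R]_(l, m)) :
  coef_polytope A !=set0 -> closure (coef_polytope A) = closed_polytope A.
Proof.
move=> [x0 [[Ax0 x0p] [x0n x01]]]; apply/seteqP; split => x.
  move=> Px.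
  have lin (w : 'rV_m) c : (forall y, coef_polytope A y -> dotv w y = c) -> dotv w x = c.
    move=> wc; apply/eqP; rewrite eq_le; apply/andP; split.
    - rewrite -subr_ge0; apply: (@closure_ge0 _ _ _ (fun y => c - dotv w y)) _ _ _ Px => [y|y /wc ->].
        by apply: continuousB; [exact: cst_continuous|exact: continuous_dotv].
      by rewrite subrr.
    - rewrite -subr_ge0; apply: (@closure_ge0 _ _ _ (fun y => dotv w y - c)) _ _ _ Px => [y|y /wc ->].
        by apply: continuousB; [exact: continuous_dotv|exact: cst_continuous].
      by rewrite subrr.
  split; last split.
  - apply/colP => i; rewrite [RHS]mxE.
    rewrite mulmx_tr_dotv; apply: lin => y [[Ay _] _].
    by rewrite -mulmx_tr_dotv Ay mxE.
  - move=> i; apply: (@closure_ge0 _ _ _ (fun y : 'rV_m => y 0 i)) _ _ _ Px => [|y [[_ y0] _]].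
      exact: coord_continuous.
    exact: ltW.
  - by apply: lin => y [_ []].
move=> [Ax [xn x1]].
pose z (t : R) := (1 - t) *: x + t *: x0.
have zP t : 0 < t < 1 -> coef_polytope A (z t).
  move=> /andP[t0 t1].
  have zp i : 0 < z t 0 i.
    rewrite !mxE; apply: ltr_wpDl; last exact: mulr_gt0.
    by rewrite mulr_ge0 ?subr_ge0 ?xn ?ltW.
  split; split.
  - by rewrite /= linearD !linearZ /= mulmxDr -!scalemxAr Ax Ax0 !scaler0 addr0.
  - exact: zp.
  - by move=> i; exact/ltW/zp.
  - by rewrite dotvDr !dotvZr x1 x01; ring.
have zx : z t @[t --> 0^'+] --> x.
  rewrite [X in _ --> X](_ : x = z 0); last by rewrite /z subr0 scale1r scale0r addr0.
  apply: cvg_at_right_filter.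
  apply: cvgD; apply: cvgZr_tmp; last exact: cvg_id.
  by apply: cvgB; [exact: cvg_cst|exact: cvg_id].
move=> V /zx V'.
have nz : \forall t \near (0 : R)^'+, V (z t) /\ 0 < t < 1.
  near=> t; split; first by near: t.
  by apply/andP; split; near: t;
    [exact: nbhs_right_gt|exact: nbhs_right_lt].
have [t [Vt /zP Pt]] := @filter_ex R _ (at_right_proper_filter 0) _ nz.
by exists (z t).
Unshelve. all: by end_near. Qed.

(** Read for [A], these equations describe the directions of the polytope. *)
Lemma ker_augmentP {R : realType} {l m : nat} (A : 'M[R]_(l, m)) (u : 'rV[R]_m) :
  (u <= ker_augment A)%MS <-> A *m u^T = 0 /\ dotv (const_mx 1) u = 0.
Proof.
rewrite /ker_augment sub_kermx -(inj_eq trmx_inj) trmx_mul trmxK trmx0.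
rewrite /augment mul_col_mx; split.
  move=> /eqP; rewrite -[0]vsubmxK => /eq_col_mx[-> /rowP/(_ 0)].
  by rewrite dotvE !linear0 !mxE => H; split => //; rewrite -H; apply: eq_bigr => i _; rewrite !mxE.
move=> [-> u1]; apply/eqP; rewrite -[RHS]vsubmxK !linear0; congr col_mx.
apply/matrixP => i j; rewrite !ord1 [RHS]mxE -u1 dotvE.
by rewrite !mxE; apply: eq_bigr => k _; rewrite !mxE.
Qed.

Lemma closed_polytope_step {R : realType} {l m : nat} (A : 'M[R]_(l, m))
    (y u : 'rV[R]_m) (s : R) :
  closed_polytope A y -> (u <= ker_augment A)%MS ->
  (forall i, 0 <= y 0 i + s * u 0 i) -> closed_polytope A (y + s *: u).
Proof.
move=> [Ay [_ y1]] /ker_augmentP[Au u1] yu; split; last split.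
- by rewrite /= linearD linearZ /= mulmxDr -scalemxAr Ay Au scaler0 addr0.
- by move=> i; rewrite !mxE.
- by rewrite dotvDr dotvZr y1 u1 mulr0 addr0.
Qed.

Lemma closed_polytope_sub {R : realType} {l m : nat} (A : 'M[R]_(l, m))
    (x y : 'rV[R]_m) :
  closed_polytope A x -> closed_polytope A y -> (x - y <= ker_augment A)%MS.
Proof.
move=> [Ax [_ x1]] [Ay [_ y1]]; apply/ker_augmentP; split.
- by rewrite linearB /= mulmxBr Ax Ay subrr.
- by rewrite dotvDr dotvNr x1 y1 subrr.
Qed.

Lemma ex_lt0_of_sum0 {R : realType} {m : nat} (u : 'rV[R]_m) :
  dotv (const_mx 1) u = 0 -> u != 0 -> exists i, u 0 i < 0.
Proof.
move=> u1 u0; apply/not_existsP => un.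
have u_ge0 i : 0 <= u 0 i by rewrite leNgt; apply/negP/un.
move/eqP: u0; apply; apply/rowP => i; rewrite mxE.
by move: u1; rewrite dotv_sum1 => /psumr_eq0P; apply.
Qed.

(** * Vertices and linear functionals *)

(** A point that is not extreme lies inside a segment of the polytope. Its
    direction vanishes where the point does, since a convex combination of
    nonnegative numbers is zero only if all of them are; one of its two
    orientations does not decrease the functional [w]. *)
Lemma vertex_or_direction {R : realType} {l m : nat} (A : 'M[R]_(l, m))
    (w x : 'rV[R]_m) : closed_polytope A x ->
  vertices (closed_polytope A) x \/
  exists u : 'rV[R]_m, [/\ u != 0, (u <= ker_augment A)%MS, 0 <= dotv w u &
     forall i, x 0 i = 0 -> u 0 i = 0].
Proof.
move=> Kx; have [|nx] := pselect (vertices (closed_polytope A) x); first by left.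
right.
suff [a [b [t [Ka Kb t01 xE ab]]]] : exists a b t,
    [/\ closed_polytope A a, closed_polytope A b, 0 < t < 1,
        x = t *: a + (1 - t) *: b & a != b].
  have supp i : x 0 i = 0 -> a 0 i = 0 /\ b 0 i = 0.
    move: Ka Kb => [_ [/(_ i) a0 _]] [_ [/(_ i) b0 _]].
    move/andP: t01 => [t0 t1]; rewrite xE !mxE => /eqP.
    rewrite paddr_eq0 ?mulr_ge0 ?subr_ge0 ?(ltW t0) ?(ltW t1) //.
    by rewrite !mulf_eq0 subr_eq0 (gt_eqF t0) (gt_eqF t1) /= => /andP[/eqP -> /eqP ->].
  wlog wab : a b t t01 xE ab Ka Kb supp / 0 <= dotv w (b - a).
    move=> W; have [|h] := leP 0 (dotv w (b - a)); first exact: (W a b t).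
    have t01' : 0 < 1 - t < 1 by move/andP: t01 => [t0 t1]; apply/andP; split; lra.
    apply: (W b a (1 - t) t01') => //.
    + by rewrite xE addrC subKr.
    + by rewrite eq_sym.
    + by move=> i /supp [].
    + by rewrite -opprB dotvNr oppr_ge0 ltW.
  exists (b - a); split => //.
  - by rewrite subr_eq0 eq_sym.
  - exact: closed_polytope_sub.
  - by move=> i /supp [ai bi]; rewrite !mxE ai bi subrr.
apply/not_existsP => H; apply: nx; split => // a b t Ka Kb t01 xE.
have ab : a = b.
  by apply/eqP/negPn/negP => ab; apply: (H a); exists b, t.
by rewrite xE -ab -scalerDl addrC subrK scale1r.
Qed.

(** The ratio test of the simplex method: following [u] until the first
    coordinate reaches zero keeps the point in the polytope, does not decrease
    [w] and kills at least one more coordinate. *)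
Lemma support_shrink {R : realType} {l m : nat} (A : 'M[R]_(l, m))
    (w x u : 'rV[R]_m) :
  closed_polytope A x -> u != 0 -> (u <= ker_augment A)%MS -> 0 <= dotv w u ->
  (forall i, x 0 i = 0 -> u 0 i = 0) ->
  exists y, [/\ closed_polytope A y, dotv w x <= dotv w y &
    [set i | y 0 i != 0] \proper [set i | x 0 i != 0]]%SET.
Proof.
move=> Kx u0 uA wu supp.
have [i0 i0n] : exists i, u 0 i < 0.
  by apply: ex_lt0_of_sum0 => //; have /ker_augmentP[] := uA.
(* [j] is the first coordinate to vanish along [u]. *)
have [j jn jmin] := @arg_minP _ _ _ i0 (fun i => u 0 i < 0) (fun i => x 0 i / - u 0 i) i0n.
set s := x 0 j / - u 0 j in jmin.
have [_ [x_ge0 _]] := Kx.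
have s0 : 0 <= s by rewrite divr_ge0 // oppr_ge0 ltW.
exists (x + s *: u); split.
- apply: closed_polytope_step => // i.
  have [un|up] := ltP (u 0 i) 0; last by apply: addr_ge0 => //; exact: mulr_ge0.
  have := jmin i un; rewrite ler_pdivlMr ?oppr_gt0 // mulrN => h.
  by rewrite -[s * _]opprK subr_ge0.
- by rewrite dotvDr dotvZr lerDl mulr_ge0.
- apply/properP; split.
    apply/fintype.subsetP => i; rewrite !inE; apply: contra => /eqP xi.
    by rewrite !mxE xi (supp i xi) mulr0 addr0.
  exists j; rewrite !inE.
    by apply/eqP => /supp uj; rewrite uj ltxx in jn.
  rewrite !mxE /s negbK invrN mulrN mulNr divfK ?subrr //.
  by rewrite lt_eqF.
Qed.

(** What the proof needs of Minkowski's theorem, that a polytope is the convex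
    hull of its vertices. A point that is not a vertex is replaced by a no worse
    one with smaller support until a vertex is reached. *)
Lemma vertex_dominates {R : realType} {l m : nat} (A : 'M[R]_(l, m))
    (w x : 'rV[R]_m) : closed_polytope A x ->
  exists2 z, vertices (closed_polytope A) z & dotv w x <= dotv w z.
Proof.
have [k] := ubnP #|[set i | x 0 i != 0]%SET|.
elim: k x => // k IH x xk Kx.
case: (@vertex_or_direction _ _ _ A w x Kx) => [vx|]; first by exists x.
move=> [u [u0 uA wu supp]].
have [y [Ky xy yx]] := @support_shrink _ _ _ A w x u Kx u0 uA wu supp.
have [|z vz yz] := IH y _ Ky.
  by rewrite -ltnS (leq_trans _ xk) // ltnS proper_card.
by exists z => //; exact: le_trans yz.
Qed.

Lemma coef_polytopeS {R : realType} {l m : nat} (A : 'M[R]_(l, m)) :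
  coef_polytope A `<=` closed_polytope A.
Proof. by move=> y [[Ay _] sy]; split. Qed.

(** A positive point can be moved a little in every direction of T, so over the
    vertices a functional [u] from T exceeds its value at the point by an amount
    quadratic in [u]. This quantifies that the point is relatively interior,
    and it gives both injectivity and surjectivity of [param]. *)
Lemma vertex_gap {R : realType} {l m N : nat} (A : 'M[R]_(l, m))
    (v : 'I_N -> 'rV[R]_m) (y u : 'rV[R]_m) (s : R) :
  range v = vertices (closed_polytope A) -> closed_polytope A y ->
  (u <= ker_augment A)%MS -> 0 <= s -> (forall i, s * `|u 0 i| <= y 0 i) ->
  exists k, dotv y u + s * dotv u u <= dotv (v k) u.
Proof.
move=> vE Ky uA s0 su.
have Kz : closed_polytope A (y + s *: u).
  apply: closed_polytope_step => // i.
  have := su i; rewrite -[s in s * `|_|]ger0_norm // -normrM ler_norml => /andP[h _].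
  by rewrite addrC -lerBlDr sub0r.
have [z vz] := @vertex_dominates _ _ _ A u _ Kz.
move: vz; rewrite -vE => -[k _ <-] yz; exists k.
by rewrite (dotvC _ u) (dotvC (v k)) -dotvZr -dotvDr.
Qed.

Lemma pos_lower_bound {R : realType} {m : nat} (y : 'rV[R]_m) :
  pos_orthant y -> exists2 e, 0 < e & forall i, e <= y 0 i.
Proof.
move=> yp; exists (\big[Order.min/1]_i y 0 i).
  by apply/bigmin_gtP; split => // i _; exact: yp.
by move=> i; exact: bigmin_le.
Qed.

(** * Values and injectivity of the parametrization *)

Section Param.
Context {R : realType} {m k N : nat} (v : 'I_N -> 'rV[R]_m) (G : 'M[R]_(m, k)).

(** The defining equation of the weighted mean [param v G xi]: the weighted
    deviations of the vertices from it cancel. All facts about [param] below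
    are read off this equation, in which no denominator occurs. *)
Lemma paramP (xi : 'rV[R]_k) (y : 'rV[R]_m) : (0 < N)%N ->
  \sum_i expR (dotv (v i) (xi *m G^T)) *: (v i - y) = 0 <-> y = param v G xi.
Proof.
move=> N0; rewrite /param trmx_mul trmxK.
set W := \sum_(i < N) expR _.
have W0 : W != 0 by rewrite gt_eqF // sumr_gt0 // => i; exact: expR_gt0.
under eq_bigr do rewrite scalerBr.
rewrite sumrB -scaler_suml; split=> [/eqP|->].
  by rewrite subr_eq0 => /eqP ->; rewrite scalerA mulVf // scale1r.
by rewrite scalerA divff // scale1r subrr.
Qed.

Lemma dotv_moment (xi : 'rV[R]_k) w : (0 < N)%N ->
  \sum_i expR (dotv (v i) (xi *m G^T)) * dotv (v i - param v G xi) w = 0.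
Proof.
move=> N0; under eq_bigr do rewrite -dotvZl.
by rewrite -dotv_suml (paramP xi _ N0).2 // dotvE mul0mx mxE.
Qed.

End Param.

Section Parametrization.
Context {R : realType} {l m k N : nat} (A : 'M[R]_(l, m)).
Context (v : 'I_N -> 'rV[R]_m) (G : 'M[R]_(m, k)).
Context (vE : range v = vertices (closed_polytope A)).
Context (GE : orthonormal_basis_mx G (ker_augment A)).
Context (P0 : coef_polytope A !=set0).

Let vK i : closed_polytope A (v i).
Proof. by have [] : vertices (closed_polytope A) (v i) by rewrite -vE; exists i. Qed.

(** The sum of weights in [param] is thus nonzero. *)
Lemma vertices_gt0 : (0 < N)%N.
Proof.
have [y /coef_polytopeS Py] := P0.
have [z] := @vertex_dominates _ _ _ A 0 y Py.
by rewrite -vE => -[i _ _] _; case: N i => // -[].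
Qed.

Let GA (e : 'rV[R]_k) : (e *m G^T <= ker_augment A)%MS.
Proof. by have [_ <-] := GE; exact: submxMl. Qed.

(** As a weighted mean of vertices, [param v G xi] satisfies the linear
    equations. It is strictly positive because every coordinate is positive at
    some vertex: otherwise the vertices would not dominate that coordinate
    functional at a point of the nonempty [coef_polytope A]. *)
Lemma param_polytope (xi : 'rV[R]_k) : coef_polytope A (param v G xi).
Proof.
have N0 := vertices_gt0.
have M w := @dotv_moment _ _ _ _ v G xi w N0.
move: (param v G xi) M => q M.
have lin w c : (forall i, dotv (v i) w = c) -> dotv q w = c.
  move=> vc; have := M w.
  under eq_bigr do rewrite dotvDl dotvNl vc.
  rewrite -mulr_suml => /eqP; rewrite mulf_eq0 gt_eqF /=; last first.
    by apply: sumr_gt0 => // i; exact: expR_gt0.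
  by rewrite subr_eq0 => /eqP.
have pp i : 0 < q 0 i.
  have [x [[Ax xp] xs]] := P0.
  have [z] := @vertex_dominates _ _ _ A (delta_mx 0 i) x (conj Ax xs).
  rewrite -vE !dotv_delta => -[j _ <-] xz.
  have vj : 0 < v j 0 i by exact: lt_le_trans xz.
  rewrite ltNge; apply/negP => p0.
  have := M (delta_mx 0 i); under eq_bigr do rewrite (dotvC (_ - _)) dotv_delta !mxE.
  have h b : 0 <= expR (dotv (v b) (xi *m G^T)) * (v b 0 i - q 0 i).
    rewrite mulr_ge0 ?expR_ge0 // subr_ge0 (le_trans p0) //.
    by have [_ [/(_ i)]] := vK b.
  move=> /psumr_eq0P /(_ j isT) => H.
  have /eqP := H (fun b _ => h b); rewrite mulf_eq0 gt_eqF ?expR_gt0 //=.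
  by rewrite gt_eqF // subr_gt0 (le_lt_trans p0).
split; split => //.
- apply/colP => i; rewrite [RHS]mxE.
  rewrite mulmx_tr_dotv dotvC; apply: lin => j.
  rewrite dotvC -mulmx_tr_dotv.
  by have [-> _] := vK j; rewrite mxE.
- by move=> i; exact/ltW.
- rewrite dotvC; apply: lin => j; rewrite dotvC.
  by have [_ [_ ->]] := vK j.
Qed.

(** The map [param] is the gradient of the convex function
    log sum_i exp (v_i . G xi), in the coordinates given by [G]. If it takes the
    value [q] at two points, let [b i] be the deviation (v_i - q) . u for the
    difference [u] of the two. Both the weights at the first point and those at
    the second, which are proportional to the former times exp (b i), have mean
    zero against [b]; so the weighted sum of (exp (b i) - 1) * b i is zero.
    Its terms are nonnegative, hence [b] vanishes, and then [vertex_gap] forces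
    [u] to be zero. *)
Lemma param_inj : injective (param v G).
Proof.
move=> xi1 xi2 E; have N0 := vertices_gt0.
set q := param v G xi1 in E.
pose u := (xi2 - xi1) *m G^T.
pose b i := dotv (v i - q) u.
have M1 : \sum_i expR (dotv (v i) (xi1 *m G^T)) * b i = 0 by exact: dotv_moment.
have M2 : \sum_i expR (dotv (v i) (xi1 *m G^T)) * (expR (dotv q u) * (expR (b i) * b i)) = 0.
  rewrite -[RHS](@dotv_moment _ _ _ _ v G xi2 u N0) -E.
  apply: eq_bigr => i _; rewrite mulrA mulrA -!expRD; congr (expR _ * _).
  by rewrite /b /u mulmxBl !(dotvDl, dotvNl, dotvDr, dotvNr); ring.
have bE i : b i = 0.
  have S : \sum_i expR (dotv (v i) (xi1 *m G^T)) * ((expR (b i) - 1) * b i) = 0.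
    under eq_bigr do rewrite mulrBl mul1r mulrBr.
    rewrite sumrB M1 subr0.
    have : expR (dotv q u) != 0 by rewrite gt_eqF ?expR_gt0.
    move=> /mulfI; apply; rewrite mulr0 mulr_sumr -[RHS]M2.
    by apply: eq_bigr => j _; rewrite mulrCA.
  have h j : 0 <= (expR (b j) - 1) * b j.
    have [b0|b0] := leP 0 (b j).
      by rewrite mulr_ge0 // subr_ge0 -expR0 ler_expR.
    by rewrite mulr_le0 ?(ltW b0) // subr_le0 -expR0 ler_expR ltW.
  have /eqP := @psumr_eq0P _ _ xpredT _ (fun j _ => mulr_ge0 (expR_ge0 _) (h j)) S i isT.
  rewrite !mulf_eq0 gt_eqF ?expR_gt0 //= subr_eq0 -expR0 => /orP[|/eqP//].
  by move=> /eqP/expR_inj.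
have Pq : coef_polytope A q := param_polytope xi1.
have [e e0 eq] : exists2 e, 0 < e & forall i, e <= q 0 i.
  by apply: pos_lower_bound; case: Pq => [[]].
(* |u_i| <= 1 + u_i ^ 2 <= 1 + u . u, so this step keeps [q] nonnegative. *)
pose s := e / (1 + dotv u u).
have D0 : 0 < 1 + dotv u u by rewrite ltr_pwDl ?dotv_ge0.
have s0 : 0 < s by exact: divr_gt0.
have sq i : s * `|u 0 i| <= q 0 i.
  apply: le_trans (eq i); rewrite /s mulrAC ler_pdivrMr // ler_pM2l //.
  have := dotv_sq_ge u i; rewrite -real_normK ?num_real // => h.
  have := sqr_ge0 (`|u 0 i| - 1); nra.
have [i] := @vertex_gap _ _ _ _ A v q u s vE (coef_polytopeS A _ Pq) (GA _) (ltW s0) sq.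
have : dotv (v i) u = dotv q u.
  by apply/eqP; rewrite -subr_eq0 -dotvNl -dotvDl -/(b i) bE.
move=> ->; rewrite gerDl pmulr_rle0 // dotv_orthonormal => [/dotv_eq0/eqP|]; last by case: GE.
by rewrite subr_eq0 => /eqP.
Qed.

End Parametrization.

(** * Minimizing sums of exponentials *)

Section ExpSum.
Context {R : realType} {k N : nat} (w : 'I_N -> 'rV[R]_k).

Definition expsum (xi : 'rV[R]_k) : R := \sum_i expR (dotv (w i) xi).

Lemma expsum_continuous : continuous expsum.
Proof.
apply: (@continuous_sumr _ _ _ (fun i xi => expR (dotv (w i) xi))) => i xi.
by apply: continuous_comp; [exact: continuous_dotv|exact: continuous_expR].
Qed.

Lemma is_derive_expsum (xi e : 'rV[R]_k) (t : R) :
  is_derive t 1 (fun s : R => expsum (xi + s *: e))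
    (\sum_i expR (dotv (w i) (xi + t *: e)) * dotv (w i) e).
Proof.
rewrite (_ : (fun s => _) =
    \sum_i (fun s : R => expR (dotv (w i) (xi + s *: e)))); last first.
  by apply/funext => s; rewrite fct_sumE.
apply: is_derive_sum => i.
apply: (@is_derive1_comp R expR (fun s => dotv (w i) (xi + s *: e))).
rewrite (_ : (fun s => _) = (cst (dotv (w i) xi) + (dotv (w i) e \*o id))); last first.
  by apply/funext => s; rewrite dotvDr dotvZr !fctE mulrC.
by apply: is_derive_eq; rewrite add0r scaler1.
Qed.

(** Fermat's rule along every line through the minimizer. *)
Lemma expsum_min_moment (xi : 'rV[R]_k) :
  (forall z, expsum xi <= expsum z) ->
  \sum_i expR (dotv (w i) xi) *: w i = 0.
Proof.
move=> mn.
have E e : \sum_i expR (dotv (w i) xi) * dotv (w i) e = 0.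
  have D : is_derive (0 : R) 1 (fun s : R => expsum (xi + s *: e)) 0.
    apply: (@derive1_at_min R _ (-1) 1) => [|t _||t _].
    - lra.
    - by case: (is_derive_expsum xi e t).
    - by rewrite in_itv /= ltrN10 ltr01.
    - by rewrite scale0r addr0.
  have D' := is_derive_expsum xi e 0.
  have := @derive_val _ _ _ _ _ _ _ D'.
  rewrite (@derive_val _ _ _ _ _ _ _ D) => E0; rewrite [RHS]E0.
  by apply: eq_bigr => i _; rewrite scale0r addr0.
apply/dotv_eq0; rewrite dotv_suml.
by under eq_bigr do rewrite dotvZl; rewrite E.
Qed.

(** Linear growth of the largest exponent makes the sum coercive, because
    exp t >= 1 + t. *)
Lemma expsum_min (c : R) : 0 < c ->
  (forall xi : 'rV[R]_k, exists i, c * `|xi| <= dotv (w i) xi) ->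
  exists xi, forall z, expsum xi <= expsum z.
Proof.
move=> c0 coer.
have lb z : 1 + c * `|z| <= expsum z.
  have [i ci] := coer z; rewrite /expsum (bigD1 i) //=.
  apply: ler_wpDr; first by apply: sumr_ge0 => j _; exact: expR_ge0.
  by apply: le_trans (expR_ge1Dx _); rewrite lerD2l.
(* Outside this ball the sum exceeds its value at 0. *)
pose K := [set z : 'rV[R]_k | `|z| <= expsum 0 / c].
have K0 : K 0.
  by rewrite /K /= normr0 divr_ge0 ?(ltW c0) // sumr_ge0 // => i _; exact: expR_ge0.
have cK : compact K.
  apply: bounded_closed_compact.
    exists (expsum 0 / c); split; first exact: num_real.
    by move=> M /ltW lM z Kz; exact: le_trans lM.
  rewrite (_ : K = (fun x : 'rV[R]_k => `|x|) @^-1` [set x | x <= expsum 0 / c]) //.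
  by apply: preimage_closed; [move=> y _; exact: norm_continuous|exact: closed_le].
have [||xi _ mn] := @EVT_min_rV R k expsum K _ cK; first by exists 0.
  by apply: continuous_subspaceT; exact: expsum_continuous.
exists xi => z; have [zK|zK] := leP `|z| (expsum 0 / c).
  by apply: mn; rewrite inE.
apply: (le_trans (mn 0 _)); first by rewrite inE.
apply: le_trans (lb z); move: zK; rewrite ltr_pdivrMr // mulrC => /ltW h.
by rewrite ler_wpDl.
Qed.

End ExpSum.

(** * Surjectivity of the parametrization *)

Lemma norm_rV_ex {R : realType} {k : nat} (x : 'rV[R]_k) :
  x != 0 -> exists i, `|x| = `|x 0 i|.
Proof.
move=> x0; have [|[i j] /= xE] := @mx_norm_neq0 R 1 k x; first by apply: contra_neq x0; exact: mx_norm_eq0.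
by exists j; move: xE; rewrite ord1.
Qed.

Section Parametrization.
Context {R : realType} {l m k N : nat} (A : 'M[R]_(l, m)).
Context (v : 'I_N -> 'rV[R]_m) (G : 'M[R]_(m, k)).
Context (vE : range v = vertices (closed_polytope A)).
Context (GE : orthonormal_basis_mx G (ker_augment A)).
Context (P0 : coef_polytope A !=set0).

(** The growth hypothesis of [expsum_min] for the exponents v_i - y: apply
    [vertex_gap] with the largest step that is certain to keep [y] nonnegative,
    so that the quadratic gap becomes a linear one. *)
Lemma vertex_coercive (y : 'rV[R]_m) : coef_polytope A y ->
  exists2 c, 0 < c & forall xi : 'rV[R]_k,
    exists i, c * `|xi| <= dotv (v i - y) (xi *m G^T).
Proof.
move=> Py; have N0 := vertices_gt0 A v vE P0.
have [e e0 ey] : exists2 e, 0 < e & forall i, e <= y 0 i.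
  by apply: pos_lower_bound; case: Py => [[]].
exists e => // xi.
have [->|xi0] := eqVneq xi 0.
  by exists (Ordinal N0); rewrite mul0mx normr0 mulr0 dotvE trmx0 mulmx0 mxE.
set u := xi *m G^T.
have uA : (u <= ker_augment A)%MS by have [_ <-] := GE; exact: submxMl.
have uu : dotv u u = dotv xi xi by apply: dotv_orthonormal; case: GE.
have u0 : u != 0.
  apply: contra_neq xi0 => u0; apply: dotv_eq0; rewrite -uu u0.
  by rewrite dotvE mul0mx mxE.
have [j uj] := norm_rV_ex u u0.
have un : 0 < `|u 0 j| by rewrite -uj normr_gt0.
have [i xii] := norm_rV_ex xi xi0.
have [|b|b hb] := @vertex_gap _ _ _ _ A v y u (e / `|u 0 j|) vE (coef_polytopeS A _ Py) uA.
- by rewrite divr_ge0 ?ltW.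
- apply: le_trans (ey b); rewrite mulrAC ler_pdivrMr // ler_pM2l //.
  rewrite -uj [leRHS]/Num.norm /= mx_normrE; apply/bigmax_geP; right.
  by exists (0, b).
exists b; rewrite dotvDl dotvNl lerBrDl; apply: le_trans hb; rewrite lerD2l.
rewrite mulrAC -mulrA ler_pM2l // ler_pdivlMr // xii.
have := dotv_sq_ge u j; have := dotv_sq_ge xi i; rewrite uu.
rewrite -[X in X <= _ -> _]real_normK ?num_real // => h1.
rewrite -real_normK ?num_real // => h2.
have := sqr_ge0 (`|xi 0 i| - `|u 0 j|); nra.
Qed.

(** The convex function xi |-> sum_i exp ((v_i - y) . G xi) attains its minimum.
    Its critical points satisfy the equation of [paramP] after projection to T,
    and the left-hand side of that equation lies in T already. *)
Lemma param_surj (y : 'rV[R]_m) : coef_polytope A y -> exists xi, param v G xi = y.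
Proof.
move=> Py; have N0 := vertices_gt0 A v vE P0.
have [c c0 hc] := vertex_coercive y Py.
have [|xi mn] := @expsum_min _ _ _ (fun i => (v i - y) *m G) c c0.
  by move=> xi; have [i] := hc xi; rewrite dotv_mulmx; exists i.
have := expsum_min_moment _ _ mn.
under eq_bigr do rewrite -dotv_mulmx scalemxAl.
rewrite -mulmx_suml => S0; exists xi; apply/esym/paramP => //.
(* [S] carries the weights exp (v_i . G xi), whereas the critical point
   equation carries exp ((v_i - y) . G xi): they differ by a common factor. *)
set S := \sum_(i < N) _.
have SE : S = expR (dotv y (xi *m G^T)) *:
    \sum_i expR (dotv (v i - y) (xi *m G^T)) *: (v i - y).
  rewrite scaler_sumr; apply: eq_bigr => i _; rewrite scalerA -expRD.
  by rewrite dotvDl dotvNl addrCA subrr addr0.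
have SA : (S <= ker_augment A)%MS.
  apply: summx_sub => i _; apply: scalemx_sub; apply: closed_polytope_sub.
    by have [] : vertices (closed_polytope A) (v i) by rewrite -vE; exists i.
  exact: coef_polytopeS.
move: SA; have [_ <-] := GE => /submxP[e Se].
apply: dotv_eq0; rewrite {2}Se dotv_mulmx SE -scalemxAl S0 scaler0.
by rewrite dotvE mul0mx mxE.
Qed.

End Parametrization.

(** * Translates and differentials *)

Lemma diff_undef {K : numFieldType} {V W : normedModType K} (f g : V -> W) (x : V) :
  ~ differentiable f x -> ~ differentiable g x -> 'd f x = 'd g x.
Proof.
have key (h : V -> W) : ~ differentiable h x -> 'd h x = point.
  move=> nh; apply: getPN => df hdf; apply: nh; apply/diffP.
  by apply: (@getI _ (fun (df : {linear V -> W}) => continuous df /\ forall z,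
      h z = h (lim (nbhs x)) + df (z - lim (nbhs x))
        +o_(z \near nbhs x) (z - lim (nbhs x))) df).
by move=> /key -> /key ->.
Qed.

(** At a point where [f] is not differentiable both sides are the same default
    map, since [f] and its translate are differentiable at the same points. *)
Lemma diff_sub_cst {K : numFieldType} {V W : normedModType K} (f : V -> W) (c : W)
    (x : V) : 'd (f - cst c) x = 'd f x :> (V -> W).
Proof.
have [fd|nf] := pselect (differentiable f x).
  rewrite (diffB fd (differentiable_cst c x)) diff_cst.
  by apply/funext => z; exact: subr0.
rewrite (@diff_undef _ _ _ (f - cst c) f x) // => fcd; apply: nf.
rewrite -[f](subrK (cst c)); exact: differentiableD fcd (differentiable_cst c x).
Qed.

Lemma jacobian_sub_cst {K : numFieldType} {k d : nat} (f : 'rV[K]_k -> 'rV[K]_d)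
    c x : 'J (fun z => f z - c) x = 'J f x.
Proof. exact: (congr1 (fun g => lin1_mx g) (diff_sub_cst f c x)). Qed.

Lemma kermx0_injective {R : realType} {k d : nat} (M : 'M[R]_(k, d)) :
  kermx M = 0 <-> injective (fun u : 'rV[R]_k => u *m M).
Proof.
split=> [/eqP|inj].
  by rewrite kermx_eq0 => /row_free_inj; exact.
apply/eqP; rewrite kermx_eq0; apply: inj_row_free => u u0.
by apply: inj; rewrite /= u0 mul0mx.
Qed.

(** * Monomials in logarithmic coordinates *)

Definition lnv {R : realType} {m : nat} (x : 'rV[R]_m) : 'rV[R]_m :=
  map_mx (@ln R) x.

(** Taking logarithms turns monomials into linear forms; the lemmas on
    [monomials] below are linear algebra for [H] in logarithmic coordinates. *)
Lemma monomialE {R : realType} {m : nat} (x z : 'rV[R]_m) :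
  pos_orthant x -> monomial x z = expR (dotv (lnv x) z).
Proof.
move=> xp; rewrite /monomial /dotv expR_sum; apply: eq_bigr => i _.
by rewrite /powR gt_eqF // mxE mulrC.
Qed.

Lemma monomialsE {R : realType} {m d : nat} (x : 'rV[R]_m) (H : 'M[R]_(m, d)) :
  pos_orthant x -> monomials x H = map_mx expR (lnv x *m H).
Proof.
move=> xp; apply/rowP => j; rewrite !mxE monomialE //; congr expR.
by apply: eq_bigr => i _; rewrite !mxE.
Qed.

Lemma map_mx_expR_inj {R : realType} {d : nat} : injective (map_mx (@expR R) : 'rV_d -> 'rV_d).
Proof.
move=> x y /rowP E; apply/rowP => i.
by have := E i; rewrite !mxE => /expR_inj.
Qed.

(** The defining equations of [solutions] run over the whole subspace D; it is
    enough to impose them on the columns of a basis matrix. *)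
Lemma monomials_eqP {R : realType} {m d : nat} (H : 'M[R]_(m, d)) (S : 'M[R]_m)
    (x y : 'rV[R]_m) : (H^T :=: S)%MS -> pos_orthant x -> pos_orthant y ->
  (forall z : 'rV[R]_m, (z <= S)%MS -> monomial x z = monomial y z) <->
  monomials x H = monomials y H.
Proof.
move=> HS xp yp; split=> [E|].
  apply/rowP => j; rewrite !mxE; apply: E.
  by rewrite -HS tr_col; exact: row_sub.
rewrite !monomialsE // => /map_mx_expR_inj E z; rewrite -HS => /submxP[w ->].
by rewrite !monomialE // !dotv_mulmx E.
Qed.

Lemma monomials_surj {R : realType} {m d : nat} (H : 'M[R]_(m, d)) (b : 'rV[R]_d) :
  row_free H^T -> pos_orthant b -> exists2 c, pos_orthant c & monomials c H = b.
Proof.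
move=> Hf bp.
have [L HL] := row_freeP Hf.
exists (map_mx expR (lnv b *m L^T)).
  by move=> i; rewrite mxE expR_gt0.
rewrite monomialsE; last by move=> i; rewrite mxE expR_gt0.
have -> : lnv (map_mx expR (lnv b *m L^T)) = lnv b *m L^T.
  by apply/rowP => i; rewrite !mxE expRK.
rewrite -mulmxA -[H]trmxK -trmx_mul HL trmx1 mulmx1.
by apply/rowP => i; rewrite !mxE lnK // posrE.
Qed.

(** * The equivalence *)

Theorem proposition8 (R : realType) (l n m : nat) (m_gt0 : (0 < m)%N)
  (A : 'M[R]_(l, m)) (B : 'M[R]_(n, m))
  (C_neq0 : coef_cone A !=set0)
  (nP : nat) (v : 'I_nP -> 'rV[R]_m) (v_inj : injective v)
  (v_vertices : range v = vertices (closure (coef_polytope A)))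
  (G : 'M[R]_(m, dimP A)) (G_basis : orthonormal_basis_mx G (ker_augment A))
  (H : 'M[R]_(m, dimD B)) (H_basis : basis_mx H (ker_augment B)) :
  (forall c : 'rV[R]_m, pos_orthant c ->
     (solutions A B c #= `I_1)%card /\
     (forall y : 'rV[R]_m, solutions A B c y -> nondegenerate_sol v G H c y))
  <->
  (set_bij [set: 'rV[R]_(dimP A)] pos_orthant (Fmap v G H) /\
   (forall xi : 'rV[R]_(dimP A), kermx ('J (Fmap v G H) xi) = 0)).
Proof.
have P0 := coef_polytope_neq0 A m_gt0 C_neq0.
have vE : range v = vertices (closed_polytope A).
  by rewrite v_vertices (closure_coef_polytope A P0).
have [Hfree HD] := H_basis.
have pP := param_polytope A v G vE P0.
have pinj := param_inj A v G vE G_basis P0.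
have psurj := param_surj A v G vE G_basis P0.
have Ppos y : coef_polytope A y -> pos_orthant y by case=> [[]].
have Fpos xi : pos_orthant (Fmap v G H xi).
  move=> i; rewrite /Fmap monomialsE ?mxE ?expR_gt0 //; exact: Ppos.
have solP c y : pos_orthant c ->
    solutions A B c y <-> coef_polytope A y /\ monomials y H = monomials c H.
  move=> cp; split=> -[Py E]; split=> //.
    by apply/(monomials_eqP _ _ _ _ HD) => //; exact: Ppos.
  by apply/(monomials_eqP _ _ _ _ HD) => //; exact: Ppos.
(* Nondegeneracy asks for some parameter of the point; by injectivity of
   [param] it is the given one. *)
have nondegP c xi : nondegenerate_sol v G H c (param v G xi) <->
    kermx ('J (Fmap v G H) xi) = 0.
  split.
    by move=> [xi' /pinj <-]; rewrite jacobian_sub_cst => /kermx0_injective.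
  by move=> J0; exists xi => //; rewrite jacobian_sub_cst; apply/kermx0_injective.
split=> [a|[[_ Finj Fsurj] J0] c cp].
  split; last first.
    move=> xi; have cp := Ppos _ (pP xi).
    have [_ nd] := a _ cp.
    by apply/(nondegP (param v G xi))/nd/(solP _ _ cp); split.
  split => [xi _|xi xi' _ _ E|b bp].
  - exact: Fpos.
  - have cp := Ppos _ (pP xi).
    have [/eq_cardSP[y _ Y0] _] := a _ cp.
    move: Y0; rewrite II0 card_eq0 => /eqP Y0.
    have Yy z : solutions A B (param v G xi) z -> z = y.
      move=> Yz; apply: contrapT => zy.
      have : (solutions A B (param v G xi) `\ y) z by split.
      by rewrite Y0.
    apply: pinj; transitivity y; [|apply/esym]; apply: Yy; apply/(solP _ _ cp).
      exact: (conj (pP xi) erefl).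
    exact: (conj (pP xi') (esym E)).
  - have [c cp <-] := @monomials_surj _ _ _ H b Hfree bp.
    have [/eq_cardSP[y Yy _] _] := a _ cp.
    have [Py yc] := (solP c y cp).1 Yy.
    have [xi xiy] := psurj y Py; exists xi => //.
    by rewrite /Fmap xiy.
have cH : pos_orthant (monomials c H).
  by move=> i; rewrite monomialsE ?mxE ?expR_gt0.
have [xi _ Fxi] := Fsurj _ cH.
have Yxi y : solutions A B c y -> y = param v G xi.
  move=> /(solP c y cp)[Py yc]; have [xi' xiy] := psurj y Py.
  have F' : Fmap v G H xi' = Fmap v G H xi by rewrite Fxi /Fmap xiy.
  by rewrite -xiy (Finj xi' xi (in_setT _) (in_setT _) F').
split; last by move=> y /Yxi ->; apply/nondegP; exact: J0.
have -> : solutions A B c = [set param v G xi].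
  apply/seteqP; split=> [y /Yxi //|_ ->].
  by apply/(solP _ _ cp); exact: (conj (pP xi) Fxi).
exact: card_set1.
Qed.
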